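(* Let $p_1,p_2\in[0,1]$ and put $q_1=1-p_1$, $q_2=1-p_2$. Then $$\begin{aligned}h(p_1)+h(p_2)={}&h(p_1p_2+q_1q_2)+(p_1p_2+q_1q_2)\,h\!\left(\frac{p_1p_2}{p_1p_2+q_1q_2}\right)\\&+(p_1q_2+p_2q_1)\,h\!\left(\frac{p_1q_2}{p_1q_2+p_2q_1}\right),\end{aligned}$$ where a term whose prefactor ($p_1p_2+q_1q_2$ or $p_1q_2+p_2q_1$) is $0$ is interpreted as $0$.
   Context: All logarithms are to base $2$. For $0\le p\le 1$ and $q=1-p$, $h(p)=p\log\frac1p+q\log\frac1q$ is the binary Shannon entropy, with the convention $0\log\frac10=0$. *)

(* Defs.v *)
(* Concrete classical reals of the Stdlib. *)
From Stdlib Require Export Reals.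
Open Scope R_scope.

(* The summand p log_2 (1/p), with the convention 0 log_2 (1/0) = 0 made
   explicit rather than inherited from the junk values of [Rinv] and [ln]. *)
Definition plogp (p : R) : R :=
  if Req_dec_T p 0 then 0 else p * Rlog 2 (1 / p).

(* Binary Shannon entropy in bits; meaningful for 0 <= p <= 1 only. *)
Definition h (p : R) : R := plogp p + plogp (1 - p).

(* Main.v *)
(** Additivity of entropy: [plogp] is a derivation on the nonnegative reals
    ([plogp_mult]), whence the grouping rule [plogp_grouping].  Grouping the four
    joint probabilities [p1 p2], [q1 q2], [p1 q2], [p2 q1] in two pairs gives
    the right-hand side; expanding each by the derivation rule gives the left. *)
Require Import Defs.
From Stdlib Require Import Reals Lra.
Open Scope R_scope.

Lemma plogp_0 : plogp 0 = 0.
Proof. unfold plogp; destruct (Req_dec_T 0 0); lra. Qed.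

Lemma plogp_pos (p : R) : 0 < p -> plogp p = - (p * ln p / ln 2).
Proof.
  intros Hp; unfold plogp, Rlog.
  destruct (Req_dec_T p 0) as [Hp0|_]; [lra|].
  unfold Rdiv at 2; rewrite Rmult_1_l, ln_Rinv by exact Hp.
  unfold Rdiv; ring.
Qed.

(** Comes from [ln (a * b) = ln a + ln b]; at a zero factor the convention at 0 takes over. *)
Lemma plogp_mult (a b : R) : 0 <= a -> 0 <= b ->
  plogp (a * b) = a * plogp b + b * plogp a.
Proof.
  intros [Ha|<-] [Hb|<-].
  - rewrite !plogp_pos, ln_mult by auto using Rmult_lt_0_compat.
    unfold Rdiv; ring.
  - rewrite Rmult_0_r, plogp_0; ring.
  - rewrite Rmult_0_l, plogp_0; ring.
  - rewrite Rmult_0_r, plogp_0; ring.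
Qed.

Lemma plogp_grouping (a b : R) : 0 <= a -> 0 <= b ->
  plogp (a + b) + (a + b) * h (a / (a + b)) = plogp a + plogp b.
Proof.
  intros Ha Hb.
  destruct (Req_dec_T (a + b) 0) as [Hs|Hs].
  - assert (a = 0) as -> by lra; assert (b = 0) as -> by lra.
    rewrite Rplus_0_r, plogp_0; ring.
  - set (s := a + b) in *.
    assert (Hi : 0 <= / s)
      by (apply Rlt_le, Rinv_0_lt_compat; unfold s in *; lra).
    assert (Hs0 : 0 <= s) by (unfold s; lra).
    assert (Hcompl : 1 - a / s = b / s)
      by (replace b with (s - a) by (unfold s; ring); field; exact Hs).
    assert (Hscale : forall c, 0 <= c ->
              plogp c = s * plogp (c / s) + c / s * plogp s).
    { intros c Hc; rewrite <- plogp_mult.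
      - f_equal; field; exact Hs.
      - exact Hs0.
      - apply Rmult_le_pos; assumption. }
    (* Turning [b / s] back into [1 - a / s] lets [ring] see that the two weights of [plogp s] add
       up to 1. *)
    unfold h; rewrite Hcompl, (Hscale a Ha), (Hscale b Hb), <- Hcompl; ring.
Qed.

(* When a prefactor is 0, the quotient inside [h] is a junk value, but its term
   is 0 * _ = 0, which is the intended reading. *)
Theorem mainTheorem3 (p1 p2 : R) (hp1 : 0 <= p1 <= 1) (hp2 : 0 <= p2 <= 1) :
  let q1 := 1 - p1 in
  let q2 := 1 - p2 in
  h p1 + h p2 =
    h (p1 * p2 + q1 * q2)
    + (p1 * p2 + q1 * q2) * h (p1 * p2 / (p1 * p2 + q1 * q2))
    + (p1 * q2 + p2 * q1) * h (p1 * q2 / (p1 * q2 + p2 * q1)).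
Proof.
  intros q1 q2.
  assert (Hq1 : 0 <= q1) by (unfold q1; lra).
  assert (Hq2 : 0 <= q2) by (unfold q2; lra).
  destruct hp1 as [Hp1 _], hp2 as [Hp2 _].
  assert (Hc : 1 - (p1 * p2 + q1 * q2) = p1 * q2 + p2 * q1)
    by (unfold q1, q2; ring).
  assert (Hsame := plogp_grouping (p1 * p2) (q1 * q2)
    (Rmult_le_pos _ _ Hp1 Hp2) (Rmult_le_pos _ _ Hq1 Hq2)).
  assert (Hdiff := plogp_grouping (p1 * q2) (p2 * q1)
    (Rmult_le_pos _ _ Hp1 Hq2) (Rmult_le_pos _ _ Hp2 Hq1)).
  rewrite !plogp_mult in Hsame, Hdiff by assumption.
  (* The two summands of this [h] are the leading terms of [Hsame] and [Hdiff]. *)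
  unfold h at 3; rewrite Hc.
  (* The expanded sum over the four joint probabilities: each [plogp] in it has total weight
     [p1 + q1] or [p2 + q2], which is 1. *)
  transitivity
    (p1 * plogp p2 + p2 * plogp p1 + (q1 * plogp q2 + q2 * plogp q1)
     + (p1 * plogp q2 + q2 * plogp p1 + (p2 * plogp q1 + q1 * plogp p2))).
  - unfold h, q1, q2; ring.
  - rewrite <- Hsame, <- Hdiff; ring.
Qed.
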